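(* Let $f:\mathbb N\to\mathbb N$ be a function with $f(n)\to\infty$ as $n\to\infty$. For every $n$ such that $f(n)\ge 3$ and $f(n)$ divides $n-2$, let $G_n$ be the generalized theta graph with $(n-2)/f(n)$ paths each having exactly $f(n)$ internal nodes. Then $G_n$ has $n$ vertices and $n(1+1/f(n))-2(1+1/f(n))$ edges (so edge density $1+1/f(n)-\frac{2}{n}(1+1/f(n))$), and Broadcast on $G_n$ requires exactly $(n-2)/f(n)$ ignorant agents, i.e. it is solvable with $k$ ignorant agents if and only if $k\ge (n-2)/f(n)$.
   Context: Generalized theta graph: two distinct fixed nodes (the poles) joined by internally vertex-disjoint paths, each path having a prescribed number of internal nodes. Edge density of a graph with $m$ edges and $n$ nodes is $m/n$. Broadcast model: a connected base graph $G=(V,E)$ with $n$ nodes. There is one source agent holding a message $\mathcal M$ and $k\ge1$ ignorant agents (agents not holding $\mathcal M$); initially all agents occupy pairwise distinct nodes, the initial placement being chosen by the adversary. Time proceeds in synchronous rounds; in each round: (1) the adversary removes a (possibly empty) set $E'\subseteq E$ of edges such that $(V,E\setminus E')$ is connected; (2) each agent (agents have unique IDs, local memory, and see the entire current graph, the positions of all agents and which agents hold $\mathcal M$) chooses either to stay or to traverse an edge of $E\setminus E'$ incident to its current node; (3) agents move. Whenever an ignorant agent is at the same node as an agent holding $\mathcal M$, it receives $\mathcal M$ and becomes a source agent. The adversary is adaptive and knows the agents' strategy. Broadcast is solvable on $G$ with $k$ ignorant agents if the agents have a strategy such that, for every initial placement and every adversary behaviour, after finitely many rounds all agents hold $\mathcal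 M$; otherwise the adversary is said to have a winning strategy. *)

(* Defs.v *)
From HB Require Import structures.
From mathcomp Require Import all_boot all_order all_algebra.

Set Implicit Arguments.
Unset Strict Implicit.
Unset Printing Implicit Defensive.

Section Broadcast.
Variables (V : finType) (E : {set {set V}}).

Definition present_rel (P : {set {set V}}) : rel V :=
  fun u v => [set u; v] \in P.

Definition graph_connected (P : {set {set V}}) : Prop :=
  forall x y : V, connect (present_rel P) x y.

Definition valid_removal (R : {set {set V}}) : Prop :=
  R \subset E /\ graph_connected (E :\: R).

(* k ignorant agents plus one source agent: agents are 'I_k.+1,
   agent ord0 is the source. *)
Variable k : nat.
Local Notation A := ('I_k.+1).

(* configuration: positions of agents, and the set of agents holding M *)
Definition config := ({ffun A -> V} * {set A})%type.

Definition step (P : {set {set V}}) (m : {ffun A -> V}) (c : config) : config :=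
  let pos' := [ffun a => if (m a == c.1 a) || ([set c.1 a; m a] \in P)
                         then m a else c.1 a] in
  (pos', c.2 :|: [set a | [exists b in c.2, pos' b == pos' a]]).

(* A (joint, deterministic, full-information) strategy: the targets in the
   current round as a function of the initial placement and the sequence of
   removed edge sets of all rounds so far (including the current one).  Since
   everything else observable is determined by these, this is the most
   general strategy of agents with unique IDs, memory and global vision. *)
Definition strategy := {ffun A -> V} -> seq {set {set V}} -> {ffun A -> V}.

Fixpoint run (sigma : strategy) (p0 : {ffun A -> V})
    (R : nat -> {set {set V}}) (t : nat) : config :=
  match t with
  | 0 => (p0, [set ord0])
  | t'.+1 => step (E :\: R t') (sigma p0 [seq R i | i <- iota 0 t])
                  (run sigma p0 R t')
  end.

Definition broadcast_solvable : Prop :=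
  exists sigma : strategy,
    forall p0 : {ffun A -> V}, injective p0 ->
    forall R : nat -> {set {set V}}, (forall t, valid_removal (R t)) ->
    exists t, (run sigma p0 R t).2 = [set: A].

End Broadcast.

(* Generalized theta graph with p paths of q internal nodes each.      *)
(* Poles: inl false, inl true.  Internal node j of path i: inr (i, j); *)
(* path i is  inl false - (i,0) - (i,1) - ... - (i,q-1) - inl true.    *)
Definition theta_V (p q : nat) : finType := (bool + 'I_p * 'I_q)%type.

Definition theta_adj (p q : nat) : rel (theta_V p q) :=
  fun u v =>
    match u, v with
    | inl false, inr (_, j) => nat_of_ord j == 0
    | inr (_, j), inl true => nat_of_ord j == q.-1
    | inr (i, j), inr (i', j') => (i == i') && ((nat_of_ord j).+1 == j')
    | _, _ => false
    end.

Definition theta_E (p q : nat) : {set {set theta_V p q}} :=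
  [set e : {set theta_V p q} |
     [exists u : theta_V p q, exists v : theta_V p q,
        theta_adj u v && (e == [set u; v])]].

(* Main.v *)
(** On the generalized theta graph a legal removal cuts every path at most once
    and leaves at least one path intact.

    With fewer ignorant agents than paths the adversary keeps the source, on
    some path, strictly closer to one pole than all other agents. While the
    source sits at that pole, every path carrying an ignorant agent is cut next
    to it. While the source is inside the path, the edge in front of it is cut,
    and so are the edges through which ignorant agents would enter the pole
    behind it. A spare path always exists; if every other path is about to be
    left by an ignorant agent, no ignorant agent remains elsewhere and the edge
    in front of the source need not be cut.

    With at least as many ignorant agents as paths, some informed agent can
    always be made to meet an ignorant one. An agent between two agents of the
    other kind on one path is squeezed, as only one of its sides can be cut. Two
    agents on a common path walking apart bring one of them to a pole, where it
    stays as an anchor. Then agents of the other kind walk towards the anchor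
    and agents of the anchor's kind towards the opposite pole, one front agent
    per path, while the others return to their own pole and wait for an intact
    path without front agent; every removal lets somebody progress, until a
    meeting or a squeeze. *)

Require Import Defs.
From mathcomp Require Import all_boot all_order all_algebra.
From mathcomp Require Import zify ring.

Set Implicit Arguments.
Unset Strict Implicit.
Unset Printing Implicit Defensive.

Lemma eq_set2 (T : finType) (u v x y : T) :
  [set u; v] = [set x; y] -> (u = x /\ v = y) \/ (u = y /\ v = x).
Proof.
move=> e; have: u \in [set x; y] by rewrite -e set21.
have: v \in [set x; y] by rewrite -e set22.
have: x \in [set u; v] by rewrite e set21.
have: y \in [set u; v] by rewrite e set22.
by rewrite !inE; do 4![case/orP=> /eqP ?]; subst; auto.
Qed.

Lemma present_rel_sym (V : finType) (P : {set {set V}}) :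
  symmetric (present_rel P).
Proof. by move=> u v; rewrite /present_rel setUC. Qed.

Lemma valid_removalP (V : finType) (E R : {set {set V}}) :
  reflect (valid_removal E R)
    ((R \subset E) && [forall x, forall y, connect (present_rel (E :\: R)) x y]).
Proof.
apply: (iffP andP) => -[sRE conn]; split=> //.
  by move=> x y; apply: (forallP (forallP conn x)).
by apply/forallP => x; apply/forallP.
Qed.

(** * Paths of the theta graph *)

Section ThetaPaths.
Variables p q : nat.
Local Notation V := (theta_V p q).
Implicit Types (u v w : V) (o : bool) (b : 'I_p) (h : nat).

Definition path_of v : option 'I_p := if v is inr (b, _) then Some b else None.

Definition on_path b v := (path_of v == None) || (path_of v == Some b).

(* The distance to the pole [inl o] along any path through the vertex. *)
Definition height o v : nat :=
  match v with
  | inl x => if x == o then 0 else q.+1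
  | inr (_, j) => if o then q - j else j.+1
  end.

(* Every height [h > q] yields the pole [inl (~~ o)]. *)
Definition node o b h : V :=
  if h == 0 then inl o
  else if insub h.-1 is Some j then inr (b, if o then rev_ord j else j)
  else inl (~~ o).

Definition edge o b h : {set V} := [set node o b h; node o b h.+1].

(* The edge and the vertex that follow [v] on path [b] when walking away from
   the pole [inl o]. *)
Definition edge_ahead o b v := edge o b (height o v).

Definition node_ahead o b v := node o b (height o v).+1.

Lemma heightD o v : height o v + height (~~ o) v = q.+1.
Proof. by case: v => [x|[b [j ltj]]] /=; case: o => /=; try case: x => /=; lia. Qed.

Lemma height_le o v : height o v <= q.+1.
Proof. by rewrite -(heightD o v) leq_addr. Qed.

Lemma heightN o v : height (~~ o) v = q.+1 - height o v.
Proof. by rewrite -(heightD o v) addKn. Qed.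

Lemma height_eq0 o v : height o v = 0 -> v = inl o.
Proof.
case: v => [x|[b [j ltj]]] /=; last by case: o; lia.
by case: eqP => // ->.
Qed.

Lemma height_eqS o v : height o v = q.+1 -> v = inl (~~ o).
Proof. by move=> e; apply: height_eq0; rewrite heightN e subnn. Qed.

Lemma sandwich_gap o u v w :
  height o u < height o v -> height (~~ o) w < height (~~ o) v ->
  height o u + height (~~ o) w < q.
Proof. by have := heightD o v; lia. Qed.

Lemma node0 o b : node o b 0 = inl o.
Proof. by []. Qed.

Lemma nodeS o b : node o b q.+1 = inl (~~ o).
Proof. by rewrite /node /=; case: insubP => //= j; rewrite ltnn. Qed.

Lemma node_inner o b h (lt : h < q) :
  node o b h.+1 = inr (b, if o then rev_ord (Ordinal lt) else Ordinal lt).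
Proof. by rewrite /node /= insubT. Qed.

Lemma height_node o b h : h <= q.+1 -> height o (node o b h) = h.
Proof.
case: h => [|h]; first by rewrite node0 /= eqxx.
rewrite leq_eqVlt ltnS => /predU1P[->|lt]; first by rewrite nodeS /=; case: o.
by rewrite node_inner /=; case: o => //=; lia.
Qed.

Lemma path_of_node o b h :
  h <= q.+1 -> path_of (node o b h) = if 0 < h <= q then Some b else None.
Proof.
case: h => [|h] //; rewrite leq_eqVlt ltnS => /predU1P[->|lt].
  by rewrite nodeS ltnn.
by rewrite node_inner /= lt.
Qed.

Lemma on_path_node o b h : h <= q.+1 -> on_path b (node o b h).
Proof.
by move=> le; rewrite /on_path path_of_node //; case: ifP; rewrite eqxx ?orbT.
Qed.

Lemma path_of_inner o b v : path_of v = Some b -> 0 < height o v <= q.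
Proof. by case: v => [x|[b' [j ltj]]] //= _; case: o; lia. Qed.

Lemma path_of_pole o v : path_of v = None -> height o v = 0 \/ height o v = q.+1.
Proof. by case: v => [x|[]] //= _; case: ifP; auto. Qed.

Lemma on_path_inner o b v :
  on_path b v -> 0 < height o v <= q -> path_of v = Some b.
Proof. by move=> /orP[/eqP /(path_of_pole o)|/eqP //]; lia. Qed.

Lemma path_on_path b v : path_of v = Some b -> on_path b v.
Proof. by rewrite /on_path => ->; rewrite eqxx orbT. Qed.

Lemma pole_on_path b v : path_of v = None -> on_path b v.
Proof. by rewrite /on_path => ->. Qed.

Lemma on_path_eq b c v : on_path b v -> path_of v = Some c -> b = c.
Proof. by rewrite /on_path => /[swap] -> /eqP[]. Qed.

Lemma on_two_paths o b c v : on_path b v -> on_path c v -> b != c ->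
  height o v = 0 \/ height o v = q.+1.
Proof.
move=> bv; rewrite /on_path => /orP[/eqP/path_of_pole //|/eqP/(on_path_eq bv)->].
by rewrite eqxx.
Qed.

Lemma node_height o b v : on_path b v -> node o b (height o v) = v.
Proof.
case: v => [x|[b' j]] => [_ | /(_ =P Some b) [->]] /=.
  by have [->|] := eqVneq x o; rewrite ?nodeS //; case: x o => [] [].
have ltj := ltn_ord j; case: o; last first.
  by rewrite node_inner; congr (inr (_, _)); apply: val_inj.
have -> : q - j = (q - j.+1).+1 by lia.
have lt : q - j.+1 < q by lia.
by rewrite (node_inner _ _ lt); congr (inr (_, _)); apply: val_inj => /=; lia.
Qed.

Lemma height_inj o b u v :
  on_path b u -> on_path b v -> height o u = height o v -> u = v.
Proof. by move=> bu bv e; rewrite -(node_height o bu) e node_height. Qed.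

Lemma nodeN o b h : h <= q.+1 -> node (~~ o) b h = node o b (q.+1 - h).
Proof.
move=> le; apply: (@height_inj (~~ o) b); rewrite ?on_path_node ?heightN ?leq_subr //.
by rewrite -(heightN o) !height_node ?leq_subr // subKn.
Qed.

Lemma edgeN o b h : h <= q -> edge (~~ o) b h = edge o b (q - h).
Proof.
move=> le; rewrite /edge !nodeN //; last exact: leqW.
by rewrite subSn // subSS setUC.
Qed.

Lemma edge_aheadE o b v :
  on_path b v -> edge_ahead o b v = [set v; node_ahead o b v].
Proof. by move=> bv; rewrite /edge_ahead /edge node_height. Qed.

Lemma height_node_ahead o b v :
  height o v <= q -> height o (node_ahead o b v) = (height o v).+1.
Proof. by move=> le; rewrite height_node. Qed.

Lemma height_node_aheadN o b v :
  height o v <= q -> height (~~ o) (node_ahead o b v) = (height (~~ o) v).-1.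
Proof. by move=> le; rewrite !heightN height_node_ahead // subnS. Qed.

Lemma on_path_node_ahead o b v : height o v <= q -> on_path b (node_ahead o b v).
Proof. by move=> le; rewrite on_path_node. Qed.

Lemma path_of_node_ahead o b v :
  height o v < q -> path_of (node_ahead o b v) = Some b.
Proof. by move=> lt; rewrite path_of_node ?lt // ltnW. Qed.

Lemma edge_inj o b b' h h' :
  0 < q -> h <= q -> h' <= q -> edge o b h = edge o b' h' -> b = b' /\ h = h'.
Proof.
move=> q_gt0 le le' /eq_set2 ends.
have eq_h : h = h'.
  by case: ends => -[/(congr1 (height o)) + /(congr1 (height o))];
     rewrite !height_node; lia.
subst h'; split=> //.
case: ends => -[]; last by move=> /(congr1 (height o)); rewrite !height_node; lia.
have leS := leqW le; move=> /(congr1 path_of) + /(congr1 path_of).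
rewrite !path_of_node //.
by case: (posnP h) => [->|_] /=; [rewrite q_gt0 => _ [] | rewrite le => -[]].
Qed.

End ThetaPaths.

Arguments path_of {p q} v.
Arguments node {p q} o b h.
Arguments edge {p q} o b h.

(** * Edges and legal removals of the theta graph *)

Section ThetaEdges.
Variables p q : nat.
Hypothesis q_gt0 : 0 < q.
Local Notation V := (theta_V p q).
Local Notation E := (theta_E p q).
Implicit Types (u v : V) (o : bool) (b : 'I_p) (h : nat) (R : {set {set V}}).

Lemma theta_adj_node_ahead u v : theta_adj u v ->
  exists b, [/\ on_path b u, height false u <= q & v = node_ahead false b u].
Proof.
have inrE b (j : 'I_q) : inr (b, j) = node false b j.+1 :> V.
  by rewrite -[LHS](@node_height _ _ false b) // /on_path /= eqxx.
case: u v => [[]|[b j]] [[]|[b' j']] //=.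
- by move/eqP=> ej; exists b'; split=> //; rewrite inrE ej /node_ahead /=.
- move/eqP=> ej; exists b; split; rewrite /on_path /= ?eqxx ?orbT //.
  by rewrite /node_ahead /= ej prednK // nodeS.
- move=> /andP[/eqP<- /eqP ej]; exists b; split; rewrite /on_path /= ?eqxx ?orbT //.
  by rewrite inrE -ej.
Qed.

Lemma node_ahead_theta_adj b u :
  on_path b u -> height false u <= q -> theta_adj u (node_ahead false b u).
Proof.
case: u => [[]|[b' j]] //; first by rewrite ltnn.
  by rewrite /node_ahead node_inner.
move=> /(_ =P Some b) [->] _; rewrite /node_ahead /=.
have [lt|ge] := ltnP j.+1 q; first by rewrite node_inner /= !eqxx.
have ej : j.+1 = q by apply/eqP; rewrite eqn_leq ge ltn_ord.
by rewrite ej nodeS /= -eqSS ej prednK.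
Qed.

Lemma theta_edgeP o (e : {set V}) :
  reflect (exists b, exists2 h, h <= q & e = edge o b h) (e \in E).
Proof.
suff: reflect (exists b, exists2 h, h <= q & e = edge false b h) (e \in E).
  move/iffP; apply; case: o => // -[b [h le ->]]; exists b; exists (q - h);
    rewrite ?leq_subr //; [exact: (@edgeN _ _ true) | exact: (@edgeN _ _ false)].
rewrite inE.
apply: (iffP existsP) => [[u /existsP[v /andP[uv /eqP->]]]|[b [h le ->]]].
  have [b [bu le ->]] := theta_adj_node_ahead uv.
  exists b; exists (height false u) => //.
  by rewrite -/(edge_ahead _ _ _) edge_aheadE.
exists (node false b h); apply/existsP; exists (node false b h.+1).
rewrite eqxx andbT; have := @node_ahead_theta_adj b (node false b h).
by have leS := leqW le; rewrite /node_ahead on_path_node ?height_node //; apply.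
Qed.

Lemma edge_in o b h : h <= q -> edge o b h \in E.
Proof. by move=> le; apply/(theta_edgeP o); exists b; exists h. Qed.

Lemma card_theta_V : #|V| = p * q + 2.
Proof. by rewrite card_sum card_bool card_prod !card_ord addnC. Qed.

Lemma card_theta_E : #|E| = p * q.+1.
Proof.
have -> : E = [set edge false x.1 x.2 | x : 'I_p * 'I_q.+1].
  apply/setP => e; apply/(theta_edgeP false)/imsetP => [[b [h le ->]]|[[b h] _ ->]].
    by exists (b, inord h); rewrite //= inordK.
  by exists b; exists h; rewrite // -ltnS.
rewrite card_imset ?card_prod ?card_ord // => -[b h] [b' h'] /=.
by case/edge_inj; rewrite -1?ltnS // => -> /val_inj ->.
Qed.

Lemma connected_invariant R o (K : pred V) : valid_removal E R ->
    (forall b h, h <= q -> edge o b h \notin R ->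
       K (node o b h) = K (node o b h.+1)) ->
  forall u v, K u = K v.
Proof.
move=> [_ conn] invK u v; apply: (@closed_connect _ (present_rel (E :\: R)) K) => //.
move=> x y; rewrite /present_rel inE => /andP[+ /(theta_edgeP o)[b [h le e]]].
rewrite e => /invK -/(_ le) eK; rewrite /in_mem /=.
by case: (eq_set2 e) => -[-> ->].
Qed.

Lemma cut_uniq R o b h h' : valid_removal E R -> h <= q -> h' <= q ->
  edge o b h \in R -> edge o b h' \in R -> h = h'.
Proof.
move=> vR; wlog lt : h h' / h < h'.
  move=> uniq_lt; case: (ltngtP h h') => // lt; first exact: uniq_lt.
  by move=> *; symmetry; apply: uniq_lt.
move=> le le' cut cut'.
pose between v := (path_of v == Some b) && (h < height o v <= h').
have between_node c i : i <= q.+1 ->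
    between (node o c i) = (c == b) && (h < i <= h').
  move=> lei; rewrite /between path_of_node // height_node //.
  by case: ifP => // inner; rewrite -[RHS]/((c == b) && _); lia.
have inv c i : i <= q -> edge o c i \notin R ->
    between (node o c i) = between (node o c i.+1).
  move=> lei ncut; have leiS := leqW lei; rewrite !between_node //.
  case: eqP => //= ecb; subst c.
  have ni : i != h by apply: contraNneq ncut => ->.
  have ni' : i != h' by apply: contraNneq ncut => ->.
  lia.
have := connected_invariant vR inv (node o b h) (node o b h').
by rewrite !between_node ?leqW // eqxx ltnn lt leqnn.
Qed.

Lemma cut_heightD R o b u v : valid_removal E R ->
    height o u <= q -> height (~~ o) v <= q ->
    edge_ahead o b u \in R -> edge_ahead (~~ o) b v \in R ->
  height o u + height (~~ o) v = q.
Proof.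
move=> vR le_u le_v cut_u; rewrite /edge_ahead edgeN // => cut_v.
by rewrite (cut_uniq vR _ _ cut_u cut_v) ?leq_subr // subnK.
Qed.

Lemma intact_path R : valid_removal E R ->
  exists b, forall o h, h <= q -> edge o b h \notin R.
Proof.
move=> vR.
have [/existsP[b /forallP uncut]|] :=
  boolP [exists b, [forall h : 'I_q.+1, edge false b h \notin R]].
  have uncut_false h : h <= q -> edge false b h \notin R.
    by move=> le; have := uncut (inord h); rewrite inordK.
  exists b => -[] h le; last exact: uncut_false.
  by rewrite (@edgeN _ _ false) // uncut_false ?leq_subr.
rewrite negb_exists => /forallP allcut; exfalso.
have /fin_all_exists [cut cutP] :
    forall b, exists h : 'I_q.+1, edge false b h \in R.
  move=> b; have := allcut b; rewrite negb_forall => /existsP[h /negPn].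
  by exists h.
pose below v :=
  if path_of v is Some b then height false v <= cut b else height false v == 0.
have below_node b h : h <= q.+1 -> below (node false b h) = (h <= cut b).
  move=> le; rewrite /below path_of_node // height_node //; have := ltn_ord (cut b).
  by case: ifP => [//|]; lia.
have inv b h : h <= q -> edge false b h \notin R ->
    below (node false b h) = below (node false b h.+1).
  move=> le ncut; have leS := leqW le; rewrite !below_node //.
  have : h != cut b by apply: contraNneq ncut => ->.
  lia.
by have := connected_invariant vR inv (inl false) (inl true).
Qed.

End ThetaEdges.

(** * The broadcast game on an arbitrary graph *)

Section WinningConfigurations.
Variables (V : finType) (E : {set {set V}}) (k : nat).
Local Notation A := ('I_k.+1).
Local Notation placement := {ffun A -> V}.
Implicit Types (X : {set {set V}}) (R : nat -> {set {set V}}) (c : config V k).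
Implicit Types (pos : placement) (C : pred A).

Fixpoint run_from (tau : seq {set {set V}} -> placement) c R t : config V k :=
  if t is t'.+1 then
    step (E :\: R t') (tau [seq R i | i <- iota 0 t]) (run_from tau c R t')
  else c.

Lemma run_fromE sigma pos R t :
  run E sigma pos R t = run_from (sigma pos) (pos, [set ord0]) R t.
Proof. by elim: t => //= t ->. Qed.

Definition wins c := exists tau, forall R, (forall t, valid_removal E (R t)) ->
  exists t, (run_from tau c R t).2 = [set: A].

Lemma wins_full pos : wins (pos, [set: A]).
Proof. by exists (fun=> pos) => R _; exists 0. Qed.

Lemma wins_step c :
  (forall X, valid_removal E X -> exists m, wins (step (E :\: X) m c)) -> wins c.
Proof.
move=> wins_next.
have /fin_all_exists [reply replyP] : forall X, exists mt : _ * _,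
    valid_removal E X -> forall R, (forall t, valid_removal E (R t)) ->
    exists t, (run_from mt.2 (step (E :\: X) mt.1 c) R t).2 = [set: A].
  move=> X; have [/wins_next[m [tau tauP]]|nvX] := valid_removalP E X.
    by exists (m, tau).
  by exists (c.1, fun=> c.1).
pose tau (h : seq {set {set V}}) :=
  if h is X :: h' then if h' is [::] then (reply X).1 else (reply X).2 h' else c.1.
exists tau => R vR.
have [t done_t] := replyP (R 0) (vR 0) (fun t => R t.+1) (fun t => vR t.+1).
exists t.+1; rewrite -done_t; congr (_.2).
elim: t {done_t} => [|t IHt] //; rewrite [LHS]/= -/(run_from _ _ _ t.+1) IHt /=.
by rewrite (iotaDl 1 1) -map_comp.
Qed.

Lemma wins_solvable :
  (forall pos, wins (pos, [set ord0])) -> broadcast_solvable E k.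
Proof.
move=> /fin_all_exists [sigma sigmaP]; exists sigma => pos _ R vR.
by have [t done_t] := sigmaP pos R vR; exists t; rewrite run_fromE.
Qed.

Definition upd pos a v : placement := [ffun x => if x == a then v else pos x].

Lemma updE pos a v : upd pos a v a = v.
Proof. by rewrite ffunE eqxx. Qed.

Lemma updNE pos a v x : x != a -> upd pos a v x = pos x.
Proof. by rewrite ffunE => /negPf ->. Qed.

(* The agents, coloured by [C], move one at a time. In the applications [C] is
   the set of informed agents, but the game is symmetric in the two colours. *)
Inductive forces_meeting C pos : Prop :=
| MeetingNow a b of C a != C b & pos a = pos b
| MeetingLater of forall X, valid_removal E X -> can_force C pos X
with can_force C pos : {set {set V}} -> Prop :=
| CanForce X a v of [set pos a; v] \in E :\: X & forces_meeting C (upd pos a v) :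
    can_force C pos X.

Lemma step_upd X c a v :
  [set c.1 a; v] \in E :\: X -> (step (E :\: X) (upd c.1 a v) c).1 = upd c.1 a v.
Proof.
move=> av; apply/ffunP => x; rewrite !ffunE /=.
by case: (x =P a) => [->|_]; rewrite ?av ?eqxx ?orbT.
Qed.

Lemma step_meeting P pos (S : {set A}) a b : a \in S -> b \notin S ->
  pos a = pos b -> S \proper (step P pos (pos, S)).2.
Proof.
move=> aS bS e; rewrite properE subsetUl; apply/subsetPn; exists b => //.
rewrite !inE; apply/orP; right; apply/existsP; exists a.
by rewrite aS !ffunE e !eqxx.
Qed.

Lemma wins_forces_meeting (S : {set A}) :
    (forall c, S \proper c.2 -> wins c) ->
  forall pos, forces_meeting (mem S) pos -> wins (pos, S).
Proof.
(* The recursion passes through [can_force], so the generated induction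
   principle is too weak. *)
move=> wins_larger; fix wins_forces 2 => pos [a b Cab e_ab|force_move].
  apply: wins_step => X _; exists pos; apply: wins_larger.
  move: Cab => /=.
  case: (boolP (a \in S)) (boolP (b \in S)) => aS [] bS // _.
    exact: step_meeting e_ab.
  exact: step_meeting (esym e_ab).
apply: wins_step => _ /force_move[X a v av /wins_forces wins_upd].
exists (upd pos a v); set c := step _ _ _.
have ec1 : c.1 = upd pos a v by apply: (step_upd (c := (pos, S))).
have [ec2|grown] := eqVneq c.2 S; first by rewrite [c]surjective_pairing ec1 ec2.
by apply: wins_larger; rewrite properEneq eq_sym grown subsetUl.
Qed.

Lemma solvable_of_forces_meeting :
    (forall (S : {set A}) a b pos, a \in S -> b \notin S ->
       forces_meeting (mem S) pos) ->
  broadcast_solvable E k.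
Proof.
move=> force; apply: wins_solvable => pos; move: pos [set _] (set11 (ord0 : A)).
suff main n pos (S : {set A}) : #|~: S| < n -> ord0 \in S -> wins (pos, S).
  by move=> pos S; apply: (main #|~: S|.+1).
elim: n => // n IHn in pos S *; rewrite ltnS => leSn S0.
have [->|] := eqVneq S [set: A]; first exact: wins_full.
rewrite -subTset => /subsetPn[b _ bS].
apply: wins_forces_meeting (force S _ _ pos S0 bS) => -[pos' S'] /= ltSS'.
apply: IHn; last exact: (subsetP (proper_sub ltSS')).
by apply: leq_trans leSn; apply: proper_card; rewrite properC.
Qed.

End WinningConfigurations.

Arguments MeetingNow {V E k C pos a b}.

Section Evasion.
Variables (V : finType) (E : {set {set V}}) (k : nat).
Local Notation A := ('I_k.+1).
Local Notation placement := {ffun A -> V}.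
Implicit Types (pos : placement) (X P : {set {set V}}).

Definition moves_along P pos pos' :=
  forall a, pos' a = pos a \/ [set pos a; pos' a] \in P.

Lemma step_moves_along P m (c : config V k) : moves_along P c.1 (step P m c).1.
Proof.
move=> a /=; rewrite ffunE.
by case: eqP => [->|_] /=; [left | case: ifP; auto].
Qed.

Definition source_alone pos := forall a : A, a != ord0 -> pos a != pos ord0.

Lemma step_source_alone P m (c : config V k) : c.2 = [set ord0] ->
  source_alone (step P m c).1 -> (step P m c).2 = [set ord0].
Proof.
move=> c0 alone; apply/setP => a; rewrite [_.2]/= c0 !inE.
have [//|na] := eqVneq a ord0.
apply/existsP => -[b]; rewrite inE => /andP[/eqP-> /eqP e].
by have := alone a na; rewrite -[_ a]e eqxx.
Qed.

Section Play.
Variables (sigma : strategy V k) (start : placement).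
Variable adversary : placement -> {set {set V}}.

(* The configuration and the removals so far when the adversary answers every
   placement by [adversary]. *)
Fixpoint play t : config V k * seq {set {set V}} :=
  if t is t'.+1 then
    let: (c, h) := play t' in
    let h' := rcons h (adversary c.1) in
    (step (E :\: adversary c.1) (sigma start h') c, h')
  else ((start, [set ord0]), [::]).

Definition play_removal t := adversary (play t).1.1.

Lemma run_play t :
  run E sigma start play_removal t = (play t).1 /\
  [seq play_removal i | i <- iota 0 t] = (play t).2.
Proof.
elim: t => [//|t [IHrun IHhist]].
have hist :
    [seq play_removal i | i <- iota 0 t.+1] = rcons (play t).2 (play_removal t).
  by rewrite -addn1 iotaD map_cat cats1 -IHhist.
have -> : run E sigma start play_removal t.+1 =
    step (E :\: play_removal t)
      (sigma start [seq play_removal i | i <- iota 0 t.+1])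
      (run E sigma start play_removal t) by [].
by rewrite hist IHrun [play t.+1]/= /play_removal; case: (play t).
Qed.

End Play.

Lemma evasion_unsolvable (safe : pred placement) (start : placement) : 0 < k ->
    injective start -> safe start -> (forall pos, safe pos -> source_alone pos) ->
    (forall pos, safe pos -> exists2 X, valid_removal E X &
       forall pos', moves_along (E :\: X) pos pos' -> safe pos') ->
  ~ broadcast_solvable E k.
Proof.
move=> k_gt0 inj_start safe_start alone evade [sigma solves].
have /fin_all_exists [adversary advP] : forall pos, exists X, safe pos ->
    valid_removal E X /\ forall pos', moves_along (E :\: X) pos pos' -> safe pos'.
  move=> pos; have [/evade[X vX safeX]|unsafe] := boolP (safe pos); first by exists X.
  by exists set0.
have inv t : safe (play sigma start adversary t).1.1 /\
    (play sigma start adversary t).1.2 = [set ord0].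
  elim: t => [//|t] /=; case: (play _ _ _ t) => c h /= [safe_c c0].
  have safe_step := (advP _ safe_c).2 _ (step_moves_along _ _ _).
  by split; [apply: safe_step | apply: step_source_alone c0 (alone _ (safe_step _))].
have [t|t] := solves start inj_start (play_removal sigma start adversary).
  exact: (advP _ (inv t).1).1.
have [-> _] := run_play sigma start adversary t; rewrite (inv t).2.
move/setP/(_ (inord 1)); rewrite !inE => /eqP/(congr1 val) /=.
by rewrite inordK.
Qed.

End Evasion.

(** * Enough agents: meetings can be forced *)

Section ForcedMeetings.
Variables (p q k : nat).
Hypothesis q_gt0 : 0 < q.
Local Notation V := (theta_V p q).
Local Notation E := (theta_E p q).
Local Notation A := ('I_k.+1).
Variable C : pred A.
Implicit Types (pos : {ffun A -> V}) (o : bool) (b : 'I_p) (R : {set {set V}}).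
Local Notation forces_meeting := (forces_meeting E C).
Local Notation can_force := (can_force E C).

Lemma force_ahead R pos o b a :
    on_path b (pos a) -> height o (pos a) <= q -> edge_ahead o b (pos a) \notin R ->
    forces_meeting (upd pos a (node_ahead o b (pos a))) ->
  can_force pos R.
Proof.
move=> ba le ncut; apply: CanForce.
by rewrite -edge_aheadE // inE ncut edge_in.
Qed.

Lemma squeeze pos o b x y z :
    C x != C y -> C z != C y ->
    on_path b (pos x) -> on_path b (pos y) -> on_path b (pos z) ->
    height o (pos x) < height o (pos y) ->
    height (~~ o) (pos z) < height (~~ o) (pos y) ->
  forces_meeting pos.
Proof.
have [n] := ubnP (q - (height o (pos x) + height (~~ o) (pos z))).
elim: n o x z pos => // n IHn o x z pos + Cxy Czy on_x on_y on_z lt_xy lt_zy.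
rewrite ltnS => le_n; apply: MeetingLater => R vR.
have closer o' x' z' : C x' != C y -> C z' != C y ->
    on_path b (pos x') -> on_path b (pos z') ->
    height o' (pos x') < height o' (pos y) ->
    height (~~ o') (pos z') < height (~~ o') (pos y) ->
    q - (height o' (pos x') + height (~~ o') (pos z')) <= n ->
    edge_ahead o' b (pos x') \notin R -> can_force pos R.
  move=> Cx Cz on_x' on_z' lt_x lt_z le_n' ncut; have gap := sandwich_gap lt_x lt_z.
  have le_x : height o' (pos x') <= q by apply: leq_trans (leq_addr _ _) (ltnW gap).
  apply: (force_ahead on_x' le_x ncut); set pos' := upd _ _ _.
  have ex : pos' x' = node_ahead o' b (pos x') by rewrite updE.
  have ey : pos' y = pos y by rewrite updNE //; apply: contraNneq Cx => ->.
  have ez : pos' z' = pos z'.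
    rewrite updNE //; apply: contraTneq gap => ->.
    by rewrite heightD -leqNgt.
  have [e|ne] := eqVneq (height o' (pos' x')) (height o' (pos y)).
    apply: (MeetingNow Cx); rewrite ey.
    by apply: (height_inj (b := b) _ _ e); rewrite ?ex ?on_path_node_ahead.
  rewrite ex height_node_ahead // in ne.
  apply: (IHn o' x' z'); rewrite ?ex ?ey ?ez ?on_path_node_ahead ?height_node_ahead //.
    by apply: leq_trans le_n'; rewrite addSn ltn_sub2l.
  by rewrite ltn_neqAle ne.
have [cut_x|ncut_x] := boolP (edge_ahead o b (pos x) \in R); last first.
  exact: (closer o x z).
have [cut_z|ncut_z] := boolP (edge_ahead (~~ o) b (pos z) \in R); last first.
  by apply: (closer (~~ o) z x); rewrite ?negbK // addnC.
have gap := sandwich_gap lt_xy lt_zy; move: (gap).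
rewrite (cut_heightD q_gt0 vR _ _ cut_x cut_z) ?ltnn //.
  exact: leq_trans (leq_addr _ _) (ltnW gap).
exact: leq_trans (leq_addl _ _) (ltnW gap).
Qed.

Hypothesis le_pk : p <= k.

Section Anchored.
Variables (o : bool) (z t : A).
Hypothesis C_tz : C t != C z.

(* Agents of the colour of the anchor [z], which stays at the pole [inl o],
   attack the pole opposite to it, the others attack the anchor; the home of an
   agent is the pole it does not attack. *)
Definition home a := if C a == C z then o else ~~ o.

Definition home_dist pos a := height (home a) (pos a).

Definition goal_dist pos a := height (~~ home a) (pos a).

Lemma home_goal_dist pos a : home_dist pos a + goal_dist pos a = q.+1.
Proof. exact: heightD. Qed.

Lemma goal_forces_meeting pos a :
  height o (pos z) = 0 -> goal_dist pos a = 0 -> forces_meeting pos.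
Proof.
move=> z_pole; rewrite /goal_dist /home; case: eqP => [Ca|/eqP Ca] a_goal; last first.
  by apply: (MeetingNow Ca); rewrite (height_eq0 a_goal) (height_eq0 z_pole) negbK.
case pt: (path_of (pos t)) => [b|]; last first.
  case/(path_of_pole o): pt => [t_pole|/height_eqS t_pole].
    by apply: (MeetingNow C_tz); rewrite (height_eq0 t_pole) (height_eq0 z_pole).
  have Cta : C t != C a by rewrite Ca.
  by apply: (MeetingNow Cta); rewrite t_pole (height_eq0 a_goal).
have /andP[t_gt0 le_t] := path_of_inner o pt.
apply: (@squeeze pos o b z t a);
  rewrite ?a_goal ?z_pole // ?heightN ?subn_gt0 ?ltnS //.
- by rewrite eq_sym.
- by rewrite Ca eq_sym.
- by rewrite (height_eq0 z_pole).
- exact: path_on_path.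
- by rewrite (height_eq0 a_goal).
Qed.

Lemma passed_forces_meeting pos b x y : height o (pos z) = 0 -> C x != C y ->
    path_of (pos x) = Some b -> path_of (pos y) = Some b ->
    height (home x) (pos y) <= home_dist pos x ->
  forces_meeting pos.
Proof.
move=> z_pole; wlog Cx : x y / C x = C z.
  move=> passed_Cx Cxy px py passed.
  have [Cx|Cx] := eqVneq (C x) (C z); first exact: (passed_Cx x y).
  have Cy : C y = C z by move: Cx Cxy; case: (C x) (C y) (C z) => [] [] [].
  apply: (passed_Cx y x) => //; first by rewrite eq_sym.
  move: passed; rewrite /home_dist /home (negPf Cx) Cy eqxx !heightN.
  by have := height_le o (pos x); lia.
move=> Cxy px py; rewrite /home_dist /home Cx eqxx leq_eqVlt => /predU1P[e|lt].
  apply: (MeetingNow Cxy).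
  by apply: (height_inj (b := b) _ _ (esym e)); apply: path_on_path.
have /andP[y_gt0 _] := path_of_inner o py.
apply: (@squeeze pos o b z y x); rewrite ?z_pole -?Cx //; try exact: path_on_path.
  by rewrite (height_eq0 z_pole).
by rewrite !heightN; have := height_le o (pos x); lia.
Qed.

Definition front pos b : option A :=
  if [pick a | path_of (pos a) == Some b] is Some a0
  then Some [arg min_(a < a0 | path_of (pos a) == Some b) goal_dist pos a]
  else None.

Definition front_dist pos b := oapp (goal_dist pos) q.+1 (front pos b).

Variant front_spec pos b : option A -> Type :=
| Front a of path_of (pos a) = Some b
    & (forall x, path_of (pos x) = Some b -> goal_dist pos a <= goal_dist pos x) :
    front_spec pos b (Some a)
| NoFront of (forall a, path_of (pos a) <> Some b) : front_spec pos b None.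

Lemma frontP pos b : front_spec pos b (front pos b).
Proof.
rewrite /front; case: pickP => [a0 pa0|none]; last first.
  by constructor => a /eqP; rewrite none.
case: arg_minnP => // a /eqP pa a_min.
by constructor=> // x /eqP; apply: a_min.
Qed.

Lemma front_path pos b f : front pos b = Some f -> path_of (pos f) = Some b.
Proof. by case: frontP => // a pa _ [<-]. Qed.

Lemma front_dist_le pos b a :
  path_of (pos a) = Some b -> front_dist pos b <= goal_dist pos a.
Proof. by rewrite /front_dist => pa; case: frontP => [f _|/(_ a)] //=; apply. Qed.

Lemma front_dist_leS pos b : front_dist pos b <= q.+1.
Proof. by rewrite /front_dist; case: front => //= a; apply: height_le. Qed.

Lemma front_dist_upd pos e v b :
  front pos b != Some e -> front_dist (upd pos e v) b <= front_dist pos b.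
Proof.
rewrite {2}/front_dist; case: frontP => [f pf _ nfe|_ _] /=; last first.
  exact: front_dist_leS.
have ef : upd pos e v f = pos f by rewrite updNE //; apply: contraNneq nfe => ->.
by rewrite /goal_dist -ef; apply: front_dist_le; rewrite ef.
Qed.

Lemma on_path_front pos b c a :
  on_path b (pos a) -> front pos c == Some a -> b = c.
Proof. by move=> ba /eqP/front_path/(on_path_eq ba). Qed.

Lemma idle_agent pos b : front pos b = None ->
  exists2 e, e != z & forall c, front pos c != Some e.
Proof.
move=> nofront; pose fronts := [set e | [exists c, front pos c == Some e]].
have card_fronts : #|fronts| <= #|[set~ b]|.
  apply: leq_trans (leq_imset_card (fun c => odflt z (front pos c)) _).
  apply/subset_leq_card/subsetP => e; rewrite inE => /existsP[c /eqP fc].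
  apply/imsetP; exists c; rewrite ?inE ?fc //.
  by apply: contra_eqN fc => /eqP->; rewrite nofront.
have /subsetPn[e] : ~~ ([set~ z] \subset fronts).
  apply/negP => /subset_leq_card; move: card_fronts.
  by rewrite !cardsC1 !card_ord; have := ltn_ord b; lia.
rewrite !inE => nez nfe; exists e => // c; apply: contra nfe => fc.
by apply/existsP; exists c.
Qed.

(* An agent that walks on as a front agent leaves its home, hence the factor
   two. *)
Definition potential pos :=
  (\sum_b front_dist pos b).*2 + \sum_a home_dist pos a.

Lemma sum_home_dist_upd pos e v :
  \sum_a home_dist (upd pos e v) a + home_dist pos e =
  \sum_a home_dist pos a + height (home e) v.
Proof.
rewrite (bigD1 e) // [X in _ = X + _](bigD1 e) //= {1}/home_dist updE.
rewrite (eq_bigr (home_dist pos)); last by move=> a ne; rewrite /home_dist updNE.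
by rewrite addnC [RHS]addnC addnCA.
Qed.

Section Progress.
Variables (pos : {ffun A -> V}) (R : {set {set V}}).
Hypothesis z_pole : height o (pos z) = 0.
Hypothesis vR : valid_removal E R.
Hypothesis lower_potential : forall pos', potential pos' < potential pos ->
  height o (pos' z) = 0 -> forces_meeting pos'.
Hypothesis goal_gt0 : forall a, 0 < goal_dist pos a.
Hypothesis unpassed : forall b x y, C x != C y ->
  path_of (pos x) = Some b -> path_of (pos y) = Some b ->
  home_dist pos x < height (home x) (pos y).

Lemma retreat b e : path_of (pos e) = Some b -> front pos b != Some e ->
  edge_ahead (~~ home e) b (pos e) \notin R -> can_force pos R.
Proof.
move=> pe nfe ncut; have /andP[e_gt0 le_e] := path_of_inner (~~ home e) pe.
apply: (force_ahead (path_on_path pe) le_e ncut); set v := node_ahead _ _ _.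
apply: lower_potential; last first.
  rewrite updNE //; apply: contra_eq_neq pe => <-.
  by rewrite (height_eq0 z_pole).
have home_v : height (home e) v = (home_dist pos e).-1.
  by rewrite -[in LHS](negbK (home e)) height_node_aheadN // negbK.
have := sum_home_dist_upd pos e v; have := home_goal_dist pos e.
have : \sum_c front_dist (upd pos e v) c <= \sum_c front_dist pos c.
  apply: leq_sum => c _; apply: front_dist_upd; apply: contra nfe => fc.
  by rewrite (on_path_front (path_on_path pe) fc).
rewrite home_v /potential -/(goal_dist pos e) in le_e *; lia.
Qed.

Lemma advance b e : e != z -> on_path b (pos e) -> home_dist pos e <= q ->
  front_dist pos b = goal_dist pos e -> edge_ahead (home e) b (pos e) \notin R ->
  can_force pos R.
Proof.
move=> nez be le_e front_e ncut.
apply: (force_ahead be le_e ncut).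
set v := node_ahead _ _ _; set pos' := upd _ _ _.
have z_pole' : height o (pos' z) = 0 by rewrite updNE // eq_sym.
have goal_v : goal_dist pos' e = (goal_dist pos e).-1.
  by rewrite /goal_dist updE height_node_aheadN.
have home_v : height (home e) v = (home_dist pos e).+1.
  exact: height_node_ahead.
have [/(goal_forces_meeting z_pole')//|v_gt0] := posnP (goal_dist pos' e).
have pv : path_of v = Some b.
  apply: path_of_node_ahead; rewrite -/(home_dist pos e).
  by have := home_goal_dist pos e; lia.
apply: lower_potential z_pole'.
have := sum_home_dist_upd pos e v; rewrite home_v -/pos'.
have : \sum_c front_dist pos' c < \sum_c front_dist pos c; last first.
  by rewrite /potential; lia.
rewrite (bigD1 b) // [X in _ < X](bigD1 b) //= -addSn leq_add //.
  have : front_dist pos' b <= goal_dist pos' e by apply: front_dist_le; rewrite updE.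
  by rewrite front_e goal_v in v_gt0 *; lia.
apply: leq_sum => c ncb; apply: front_dist_upd; apply: contra ncb => fc.
by rewrite (on_path_front be fc).
Qed.

Lemma advance_front b f : front pos b = Some f ->
  edge_ahead (home f) b (pos f) \notin R -> can_force pos R.
Proof.
move=> fb; have pf := front_path fb; have /andP[_ le_f] := path_of_inner (home f) pf.
have nfz : f != z by apply: contra_eq_neq pf => ->; rewrite (height_eq0 z_pole).
by apply: advance nfz (path_on_path pf) le_f _; rewrite /front_dist fb.
Qed.

(* The edge in front of the front agent [f] and the edge behind [e] are
   different, as [e] is behind [f] or comes towards it. *)
Lemma advance_or_retreat b e :
  path_of (pos e) = Some b -> front pos b != Some e -> can_force pos R.
Proof.
move=> pe nfe; case fb: (front pos b) => [f|]; last first.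
  by case: frontP fb => // /(_ e).
have pf := front_path fb; have /andP[_ le_f] := path_of_inner (home f) pf.
have /andP[_ le_e] := path_of_inner (~~ home e) pe.
have [cut_f|] := boolP (edge_ahead (home f) b (pos f) \in R); last first.
  exact: advance_front.
apply: (retreat pe nfe); apply/negP => cut_e.
have [Cef|Cef] := eqVneq (C e) (C f).
  have home_e : home e = home f by rewrite /home Cef.
  have := front_dist_le pe; rewrite {1}/front_dist fb /= leqNgt /goal_dist.
  rewrite home_e in cut_e le_e *; rewrite -(ltn_add2l (home_dist pos f)).
  by rewrite heightD (cut_heightD q_gt0 vR le_f le_e cut_f cut_e) ltnSn.
have home_e : ~~ home e = home f.
  by move: Cef; rewrite /home; case: (C e) (C f) (C z) (o) => [] [] [] [].
rewrite home_e in cut_e le_e; rewrite eq_sym in Cef.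
have := unpassed Cef pf pe.
by rewrite /home_dist (cut_uniq q_gt0 vR le_f le_e cut_f cut_e) ltnn.
Qed.

Lemma anchored_progress : can_force pos R.
Proof.
have [b uncut] := intact_path q_gt0 vR.
case fb: (front pos b) => [f|].
  have /andP[_ le_f] := path_of_inner (home f) (front_path fb).
  exact: advance_front fb (uncut _ _ le_f).
have [e nez nfe] := idle_agent fb.
case pe: (path_of (pos e)) => [c|]; first exact: advance_or_retreat pe (nfe c).
have e_home : home_dist pos e = 0.
  case: (path_of_pole (~~ home e) pe) (home_goal_dist pos e) (goal_gt0 e);
    by rewrite /goal_dist => ->; lia.
apply: (advance nez (pole_on_path b pe)); first by rewrite e_home.
  by rewrite /front_dist fb -(home_goal_dist pos e) e_home.
by apply: uncut; rewrite -/(home_dist pos e) e_home.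
Qed.

End Progress.

Lemma anchored_forces_meeting pos :
  height o (pos z) = 0 -> forces_meeting pos.
Proof.
have [n] := ubnP (potential pos).
elim: n pos => // n IHn pos; rewrite ltnS => le_n z_pole.
have [/existsP[a /eqP a_goal]|goal_gt0] := boolP [exists a, goal_dist pos a == 0].
  exact: goal_forces_meeting a_goal.
have [/existsP[b /existsP[x /existsP[y]]]|none_passed] :=
  boolP [exists b, exists x, exists y, [&& C x != C y, path_of (pos x) == Some b,
    path_of (pos y) == Some b & height (home x) (pos y) <= home_dist pos x]].
  move=> /and4P[Cxy /eqP px /eqP py passed].
  exact: passed_forces_meeting Cxy px py passed.
apply: MeetingLater => R vR.
apply: anchored_progress => // [pos' lt_pos'|a|b x y Cxy px py].
- by apply: IHn; apply: leq_trans le_n.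
- by rewrite lt0n; apply: contra goal_gt0 => a_goal; apply/existsP; exists a.
- rewrite ltnNge; apply: contra none_passed => passed; apply/existsP; exists b.
  by apply/existsP; exists x; apply/existsP; exists y; rewrite Cxy px py !eqxx.
Qed.

End Anchored.

Hypothesis C_nontrivial : exists x y, C x != C y.

Lemma pole_forces_meeting pos a : path_of (pos a) = None -> forces_meeting pos.
Proof.
move=> pa; have [t Cta] : exists t, C t != C a.
  have [x [y Cxy]] := C_nontrivial.
  have [e|] := eqVneq (C x) (C a); last by exists x.
  by exists y; rewrite -e eq_sym.
have [a_pole|a_pole] := path_of_pole false pa.
  exact: (anchored_forces_meeting (o := false) Cta).
apply: (anchored_forces_meeting (o := true) Cta).
by rewrite (heightN false) a_pole subnn.
Qed.

(* One of the edges on the outer sides of two agents on a common path is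
   present. *)
Lemma pair_forces_meeting pos o b x y : x != y ->
    path_of (pos x) = Some b -> path_of (pos y) = Some b ->
    height o (pos y) <= height o (pos x) ->
  forces_meeting pos.
Proof.
have [n] := ubnP (height (~~ o) (pos x) + height o (pos y)).
elim: n pos o x y => // n IHn pos o x y + nxy px py le_yx.
rewrite ltnS => le_n; apply: MeetingLater => R vR.
have apart o' x' y' : x' != y' ->
    path_of (pos x') = Some b -> path_of (pos y') = Some b ->
    height o' (pos y') <= height o' (pos x') ->
    height (~~ o') (pos x') + height o' (pos y') <= n ->
    edge_ahead o' b (pos x') \notin R -> can_force pos R.
  move=> nxy' px' py' le' le_n' ncut; have /andP[_ le_x] := path_of_inner o' px'.
  apply: (force_ahead (path_on_path px') le_x ncut); set pos' := upd _ _ _.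
  have ex : pos' x' = node_ahead o' b (pos x') by rewrite updE.
  have ey : pos' y' = pos y' by rewrite updNE // eq_sym.
  case p_new: (path_of (pos' x')) => [c|]; last exact: pole_forces_meeting p_new.
  have ecb : b = c by apply: on_path_eq p_new; rewrite ex on_path_node_ahead.
  have /andP[x_gt0 _] := path_of_inner (~~ o') px'.
  subst c; apply: (IHn pos' o' x' y' _ nxy' p_new); rewrite ?ey // ex.
    by apply: leq_trans le_n'; rewrite height_node_aheadN // ltn_add2r ltn_predL.
  by rewrite height_node_ahead // leqW.
have [cut_x|] := boolP (edge_ahead o b (pos x) \in R); last exact: (apart o x y).
have [cut_y|] := boolP (edge_ahead (~~ o) b (pos y) \in R); last first.
  apply: (apart (~~ o) y x); rewrite ?negbK 1?eq_sym 1?addnC //.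
  by rewrite !heightN leq_sub2l.
have /andP[_ le_x] := path_of_inner o px.
have /andP[_ le_y] := path_of_inner (~~ o) py.
move: le_yx; rewrite -(leq_add2r (height (~~ o) (pos y))) heightD.
by rewrite (cut_heightD q_gt0 vR le_x le_y cut_x cut_y) ltnn.
Qed.

Lemma theta_forces_meeting pos : forces_meeting pos.
Proof.
have [/existsP[a /eqP pa]|inner] := boolP [exists a, path_of (pos a) == None].
  exact: pole_forces_meeting pa.
have /fin_all_exists [f fP] : forall a, exists b, path_of (pos a) = Some b.
  move=> a; case pa: (path_of (pos a)) => [b|]; first by exists b.
  by case/existsP: inner; exists a; rewrite pa.
have [/injectiveP/leq_card|/injectivePn[x [y nxy e_xy]]] := boolP (injectiveb f).
  by rewrite !card_ord ltnNge le_pk.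
have [le|/ltnW le] := leqP (height false (pos y)) (height false (pos x)).
  by apply: pair_forces_meeting nxy (fP x) _ le; rewrite fP e_xy.
by apply: pair_forces_meeting _ (fP y) _ le; rewrite ?fP ?e_xy // eq_sym.
Qed.

End ForcedMeetings.

Lemma theta_solvable p q k :
  0 < q -> p <= k -> broadcast_solvable (theta_E p q) k.
Proof.
move=> q_gt0 le_pk; apply: solvable_of_forces_meeting => S a b pos aS bS.
by apply: theta_forces_meeting => //; exists a; exists b; rewrite /= aS (negPf bS).
Qed.

(** * Too few agents: the source can be kept alone *)

Section Cuts.
Variables p q : nat.
Hypothesis q_gt0 : 0 < q.
Local Notation V := (theta_V p q).
Local Notation E := (theta_E p q).
Implicit Types (u v : V) (o : bool) (b : 'I_p) (g : 'I_p -> nat).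

(* Path [b] is cut at height [g b]; a value [g b > q] leaves it intact. *)
Definition cuts o g : {set {set V}} :=
  [set edge o b (g b) | b in [pred b | g b <= q]].

Lemma mem_cuts o g b h : h <= q -> (edge o b h \in cuts o g) = (g b == h).
Proof.
move=> le; apply/imsetP/eqP => [[c]|e]; last by exists b; rewrite ?inE e.
by rewrite inE => lec /(edge_inj q_gt0 le lec) [-> ->].
Qed.

Lemma connect_segment o g b i j : i <= j -> j <= q.+1 ->
  (forall h, i <= h < j -> g b != h) ->
  connect (present_rel (E :\: cuts o g)) (node o b i) (node o b j).
Proof.
elim: j => [|j IHj] le_ij le_j uncut.
  by move: le_ij; rewrite leqn0 => /eqP->.
move: le_ij; rewrite leq_eqVlt => /predU1P[->//|lt_ij].
apply: (@connect_trans _ _ (node o b j)).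
  apply: IHj => // [|h /andP[le_h lt_h]]; first exact: ltnW.
  by rewrite uncut // le_h ltnW.
apply: connect1; rewrite /present_rel inE -/(edge o b j) mem_cuts // edge_in //.
by rewrite uncut // -ltnS lt_ij /=.
Qed.

Lemma cuts_valid o g b0 : q < g b0 -> valid_removal E (cuts o g).
Proof.
move=> uncut0; split.
  by apply/subsetP => e /imsetP[b]; rewrite inE => le ->; apply: edge_in.
have csym := sym_connect_sym (present_rel_sym (E :\: cuts o g)).
have top b : connect (present_rel (E :\: cuts o g)) (inl o) (node o b q.+1).
  rewrite nodeS -(nodeS q o b0) -(node0 q o b0).
  by apply: connect_segment => // h /andP[_ lt]; rewrite gtn_eqF // (leq_trans lt).
suff base v : connect (present_rel (E :\: cuts o g)) (inl o) v.
  by move=> u v; apply: connect_trans (base v); rewrite csym.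
have [b bv] : exists b, on_path b v.
  by case: v => [x|[b j]]; [exists b0 | exists b; rewrite /on_path /= eqxx].
rewrite -(node_height o bv); have [le|lt] := leqP (height o v) (g b).
  rewrite -(node0 q o b); apply: connect_segment => // [|h /andP[_ lt_h]].
    exact: height_le.
  by rewrite gtn_eqF // (leq_trans lt_h).
apply: connect_trans (top b) _; rewrite csym.
apply: connect_segment => // [|h /andP[le_h _]]; first exact: height_le.
by rewrite ltn_eqF // (leq_trans lt).
Qed.

Variant cut_move o g u v : Prop :=
| CutStay of v = u
| CutUp b of on_path b u & on_path b v
    & height o v = (height o u).+1 & g b != height o u
| CutDown b of on_path b u & on_path b v
    & height o u = (height o v).+1 & g b != height o v.

Lemma cut_moveP k o g (pos pos' : {ffun 'I_k.+1 -> V}) a :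
  moves_along (E :\: cuts o g) pos pos' -> cut_move o g (pos a) (pos' a).
Proof.
move=> /(_ a) [e|]; first exact: CutStay.
rewrite inE => /andP[+ /(theta_edgeP q_gt0 o)[b [h le e]]].
rewrite e mem_cuts // => gb; have leS := leqW le.
case: (eq_set2 e) => -[-> ->];
  [apply: (@CutUp _ _ _ _ b) | apply: (@CutDown _ _ _ _ b)];
  by rewrite ?on_path_node ?height_node.
Qed.

End Cuts.

Arguments cuts {p q} o g.

Section Evading.
Variables p q k : nat.
Hypothesis q_gt1 : 1 < q.
Hypothesis lt_kp : k < p.
Let q_gt0 : 0 < q := ltnW q_gt1.
Local Notation V := (theta_V p q).
Local Notation E := (theta_E p q).
Local Notation A := ('I_k.+1).
Implicit Types (pos : {ffun A -> V}) (v : V) (o : bool) (b c : 'I_p).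

Definition evades o b pos :=
  on_path b (pos ord0) && [forall a : A, (a != ord0) && on_path b (pos a) ==>
    (height o (pos ord0) < height o (pos a))].

Lemma evadesP o b pos :
  reflect (on_path b (pos ord0) /\ forall a : A, a != ord0 -> on_path b (pos a) ->
             height o (pos ord0) < height o (pos a))
    (evades o b pos).
Proof.
apply: (iffP andP) => -[on0 above]; split=> //.
  by move=> a na ba; have := forallP above a; rewrite na ba.
by apply/forallP => a; apply/implyP => /andP[]; apply: above.
Qed.

Definition evasive pos := [exists o, exists b, evades o b pos].

Lemma evades_evasive o b pos : evades o b pos -> evasive pos.
Proof. by move=> ev; apply/existsP; exists o; apply/existsP; exists b. Qed.

Lemma evasive_source_alone pos : evasive pos -> source_alone pos.
Proof.
move=> /existsP[o /existsP[b /evadesP[on0 above]]] a na.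
by apply/eqP => e; have := above a na; rewrite e ltnn => /(_ on0).
Qed.

Definition keeps_evasive pos := exists2 X, valid_removal E X &
  forall pos', moves_along (E :\: X) pos pos' -> evasive pos'.

Definition occupied pos b :=
  [exists a : A, (a != ord0) && (path_of (pos a) == Some b)].

Lemma some_path_unoccupied pos : exists b, ~~ occupied pos b.
Proof.
apply/existsP; rewrite -negb_forall; apply/negP => /forallP full.
have /fin_all_exists [f fP] :
    forall b, exists a : A, a != ord0 /\ path_of (pos a) = Some b.
  by move=> b; have /existsP[a /andP[na /eqP pa]] := full b; exists a.
have inj_f : injective f.
  by move=> b c e; have := (fP b).2; rewrite e (fP c).2 => -[].
have sub_f : [set f b | b in 'I_p] \subset [set~ ord0].
  by apply/subsetP => _ /imsetP[b _ ->]; rewrite !inE; case: (fP b).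
have := subset_leq_card sub_f.
by rewrite card_imset // cardsC1 !card_ord leqNgt lt_kp.
Qed.

Lemma evade_at_pole o b0 pos :
  evades o b0 pos -> height o (pos ord0) = 0 -> keeps_evasive pos.
Proof.
move=> /evadesP[on0 above] at_pole; pose g b := if occupied pos b then 0 else q.+1.
have [b1 free1] := some_path_unoccupied pos.
exists (cuts o g).
  by apply: (cuts_valid q_gt0 o (b0 := b1)); rewrite /g (negPf free1).
move=> pos' mv.
have inner_cut a c :
    a != ord0 -> on_path c (pos a) -> 0 < height o (pos a) <= q -> g c = 0.
  move=> na ca /(on_path_inner ca) pa; rewrite /g ifT //; apply/existsP; exists a.
  by rewrite na pa eqxx.
have pos_gt0 (a : A) : a != ord0 -> 0 < height o (pos a).
  move=> na; rewrite lt0n; apply/eqP => /height_eq0 e.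
  by have := above a na; rewrite e /= eqxx => /(_ isT).
have pos'_gt0 (a : A) : a != ord0 -> 0 < height o (pos' a).
  move=> na; case: (cut_moveP q_gt0 a mv) => [->|c _ _ -> //|c ca _ e gc].
    exact: pos_gt0.
  rewrite lt0n; apply: contraNneq gc => e0.
  by rewrite e0 in e *; rewrite (inner_cut a c na ca) // e.
case: (cut_moveP q_gt0 ord0 mv) => [e|b _ ob' e gb|b _ _ e];
  last by rewrite at_pole in e.
  apply: (@evades_evasive o b0); apply/evadesP; rewrite e; split=> // a na _.
  by rewrite at_pole pos'_gt0.
apply: (@evades_evasive o b); apply/evadesP; split=> // a na ba'.
have free_b c : on_path c (pos a) -> 0 < height o (pos a) <= q -> c <> b.
  by move=> ca inner ecb; move: gb; rewrite -ecb (inner_cut a c na ca inner) at_pole.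
rewrite e at_pole; case: (cut_moveP q_gt0 a mv) => [ea|c _ _ -> |c ca ca' ea _].
- rewrite ea in ba' *; have [le|] := leqP (height o (pos a)) q; last exact: ltn_trans.
  by case: (free_b b ba'); rewrite ?pos_gt0.
- by rewrite ltnS pos_gt0.
- rewrite ltn_neqAle pos'_gt0 // andbT eq_sym; apply/eqP => e1.
  have pb : path_of (pos' a) = Some b.
    by apply: (on_path_inner (o := o) ba'); rewrite e1.
  by apply: (free_b c ca); [rewrite ea e1 | apply: on_path_eq ca' pb].
Qed.

Definition threatened o pos b := [exists a : A, (a != ord0) && (pos a == node o b 1)].

Lemma all_threatened o pos b0 :
    (forall b, b != b0 -> threatened o pos b) ->
  forall a : A, a != ord0 -> exists2 b, b != b0 & pos a = node o b 1.
Proof.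
move=> threat.
have /fin_all_exists [f fP] :
    forall b, exists a : A, b != b0 -> a != ord0 /\ pos a = node o b 1.
  move=> b; have [//|nb] := eqVneq b b0; first by exists ord0.
  by have /existsP[a /andP[na /eqP ea]] := threat b nb; exists a.
have inj_f : {in [set~ b0] &, injective f}.
  move=> b c; rewrite !inE => /fP[_ eb] /fP[_ ec] e; move: ec; rewrite -e eb.
  by move=> /(congr1 path_of); rewrite !path_of_node //= q_gt0 => -[].
have : [set f b | b in [set~ b0]] == [set~ ord0].
  have le_kp : k <= p.-1 by rewrite -ltnS (ltn_predK lt_kp).
  rewrite eqEcard card_in_imset // !cardsC1 !card_ord le_kp andbT.
  by apply/subsetP => _ /imsetP[b + ->]; rewrite !inE => /fP[].
move=> /eqP/setP im a na; have := im a; rewrite !inE na => /imsetP[b + ea].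
by rewrite !inE => nb; exists b => //; rewrite ea; case: (fP b nb).
Qed.

Lemma evade_all_threatened o b0 pos : path_of (pos ord0) = Some b0 ->
  (forall b, b != b0 -> threatened o pos b) -> keeps_evasive pos.
Proof.
move=> p0 threat; pose g b := if b == b0 then q.+1 else 0.
exists (cuts o g); first by apply: (cuts_valid q_gt0 o (b0 := b0)); rewrite /g eqxx.
move=> pos' mv; apply: (@evades_evasive o b0); apply/evadesP; split.
  case: (cut_moveP q_gt0 ord0 mv) =>
    [->|b /on_path_eq/(_ p0)-> //|b /on_path_eq/(_ p0)-> //].
  exact: path_on_path.
move=> a na b0a; exfalso; have [b nb ea] := all_threatened threat na.
have pa : path_of (pos a) = Some b by rewrite ea path_of_node // q_gt0.
have ha : height o (pos a) = 1 by rewrite ea height_node.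
have inner' : on_path b (pos' a) /\ 0 < height o (pos' a) <= q.
  case: (cut_moveP q_gt0 a mv) => [->|c ca ca' e _|c ca _ e].
  - by rewrite ha; split=> //; apply: path_on_path.
  - by rewrite e ha -(on_path_eq ca pa).
  - by rewrite (on_path_eq ca pa) /g (negPf nb); move: e; rewrite ha => -[<-].
have := on_two_paths o b0a inner'.1; rewrite eq_sym => /(_ nb).
by case: inner' => _; lia.
Qed.

Lemma evade_ahead_cut o b0 b1 pos :
  evades o b0 pos -> path_of (pos ord0) = Some b0 ->
  b1 != b0 -> ~~ threatened o pos b1 -> keeps_evasive pos.
Proof.
move=> /evadesP[_ above] p0 nb1 safe1; set h0 := height o (pos ord0) in above *.
have /andP[_ le_h0] := path_of_inner o p0.
pose g b := if b == b0 then h0 else if threatened o pos b then 0 else q.+1.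
exists (cuts o g).
  by apply: (cuts_valid q_gt0 o (b0 := b1)); rewrite /g (negPf nb1) (negPf safe1).
have g0 : g b0 = h0 by rewrite /g eqxx.
move=> pos' mv; apply: (@evades_evasive o b0); apply/evadesP.
have [on0' le0'] : on_path b0 (pos' ord0) /\ height o (pos' ord0) <= h0.
  case: (cut_moveP q_gt0 ord0 mv) =>
    [->|b /on_path_eq/(_ p0)-> _ _|b /on_path_eq/(_ p0)-> ? e _].
  - by split; first exact: path_on_path.
  - by rewrite g0 eqxx.
  - by rewrite /h0 e leqnSn.
split=> // a na b0a; apply: leq_ltn_trans le0' _.
case: (cut_moveP q_gt0 a mv) => [e|c ca ca' e _|c ca ca' e gc].
- by rewrite e in b0a *; apply: above.
- have [ec|nc] := eqVneq c b0; first by rewrite e ltnW // ltnS above // -ec.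
  by case: (on_two_paths o ca' b0a nc) => e'; [rewrite e in e' | rewrite e' ltnS].
have [ec|nc] := eqVneq c b0.
  by rewrite ltn_neqAle -ltnS -e above -?ec // andbT -g0 -ec.
case: (on_two_paths o ca' b0a nc) => e'; last first.
  by have := height_le o (pos a); rewrite e e' ltnn.
case/negP: gc; rewrite /g (negPf nc) e' ifT //; apply/existsP; exists a.
by rewrite na -(node_height o ca) e e' eqxx.
Qed.

Lemma evasive_keeps_evasive pos : evasive pos -> keeps_evasive pos.
Proof.
move=> /existsP[o /existsP[b ev]]; have /evadesP[on0 above] := ev.
case p0: (path_of (pos ord0)) => [b0|]; last first.
  have [e|e] := path_of_pole o p0; first exact: evade_at_pole ev e.
  apply: (@evade_at_pole (~~ o) b); last by rewrite heightN e subnn.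
  apply/evadesP; split=> // a na ba.
  by have := above a na ba; rewrite e ltnNge height_le.
have eb := on_path_eq on0 p0; subst b0.
have [/existsP[b1 /andP[nb1 safe1]]|] :=
    boolP [exists b1, (b1 != b) && ~~ threatened o pos b1].
  exact: evade_ahead_cut nb1 safe1.
rewrite negb_exists => /forallP threat.
apply: (evade_all_threatened (o := o) p0) => b1 nb1.
by have := threat b1; rewrite nb1 negbK.
Qed.

End Evading.

Lemma theta_unsolvable p q k :
  1 < q -> 0 < k -> k < p -> ~ broadcast_solvable (theta_E p q) k.
Proof.
move=> q_gt1 k_gt0 lt_kp; have q_gt0 := ltnW q_gt1.
pose start : {ffun 'I_k.+1 -> theta_V p q} :=
  [ffun a => if unlift ord0 a is Some i
             then inr (widen_ord (ltnW lt_kp) i, Ordinal q_gt0) else inl false].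
apply: (@evasion_unsolvable _ _ _ (@evasive p q k) start) => //.
- move=> a b; rewrite !ffunE.
  case: unliftP => [i ->|->]; case: unliftP => [j ->|->] // [e].
  by congr (lift _ _); apply: val_inj.
- apply: (@evades_evasive _ _ _ false (Ordinal (leq_ltn_trans (leq0n k) lt_kp))).
  apply/evadesP; rewrite ffunE unlift_none; split=> // a na _.
  by rewrite ffunE; case: unliftP na => [i _|->].
- exact: evasive_source_alone.
- exact: evasive_keeps_evasive.
Qed.

Theorem theorem3 (f : nat -> nat)
  (f_to_infty : forall M : nat, exists N : nat, forall m : nat, N <= m -> M <= f m)
  (n : nat) (hn : 2 <= n) (hf3 : 3 <= f n) (hdiv : f n %| n - 2) :
  let p := (n - 2) %/ f n in
  let q := f n in
  #|theta_V p q| = n /\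
  ((#|theta_E p q|)%:R : rat)
     = (n%:R * (1 + (q%:R)^-1) - 2%:R * (1 + (q%:R)^-1))%R /\
  (forall k : nat, 1 <= k -> (broadcast_solvable (theta_E p q) k <-> p <= k)).
Proof.
move=> p q; have q_gt1 : 1 < q by apply: ltnW.
have q_gt0 := ltnW q_gt1; have n_eq : n = p * q + 2 by rewrite divnK // subnK.
split; first by rewrite card_theta_V -n_eq.
split.
  have q_neq0 : (q%:R != 0 :> rat)%R by rewrite Num.Theory.pnatr_eq0 -lt0n.
  by rewrite card_theta_E // n_eq GRing.natrD !GRing.natrM GRing.mulrSr; field.
move=> k k_gt0; split; last exact: theta_solvable.
by move=> solvable; rewrite leqNgt; apply/negP => /(theta_unsolvable q_gt1 k_gt0).
Qed.
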